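(* Let $(R,\mathfrak{m})$ be a finite commutative local ring with identity with residue field $R/\mathfrak{m}\simeq\mathbb{F}_q$ of prime characteristic $p$. Let $k\in\mathbb{N}$ be such that $(k,p)=1$ and put $k'=(k,q-1)$. If $\frac{q-1}{k'}\dagger q-1$, then $g_R(k)$ exists, $W_R(k)$ is connected, and $$\delta(W_R(k))=g_R(k)=\delta(G_R(k)).$$ Moreover, in this case we have the following: (a) If $G_R(k)$ is undirected, then $$g_R(k)=\begin{cases}1, & \text{if } k'=1 \text{ and } |\mathfrak{m}|=1,\\ 2, & \text{if } k'=1 \text{ and } |\mathfrak{m}|\ge 2,\\ g(k,q), & \text{if } k'>1.\end{cases}$$ (b) If $G_R(k)$ is directed, then $$g_R(k)=\begin{cases}g(k,q), & \text{if } \gamma(\Gamma(k,q))\le g(k,q) \text{ or } |\mathfrak{m}|=1,\\ g(k,q)+1, & \text{if } \gamma(\Gamma(k,q))>g(k,q) \text{ and } |\mathfrak{m}|\ge 2.\end{cases}$$ Therefore, $g_R(k)=g_{R'}(k)$ for any pair of finite commutative local rings $R,R'$ having the same (up to isomorphism) residue field.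
   Context: $(a,b)$ denotes the greatest common divisor of integers $a$ and $b$. For a ring $A$, the Waring number $g_A(k)$ is the minimum $s\in\mathbb{N}$, if it exists, such that $x_1^k+\cdots+x_s^k=r$ has a solution in $A$ for every $r\in A$; $g(k,q)=g_{\mathbb{F}_q}(k)$. $R^*$ is the group of units of $R$; $G_R(k)=Cay(R,\{x^k:x\in R^*\})$ and $W_R(k)=Cay(R,\{x^k:x\in R\smallsetminus\{0\}\})$, where $Cay(R,S)$ is the directed graph with vertex set $R$ and an arc from $v$ to $w$ if and only if $w-v\in S$; it is considered undirected if $S=-S$, and directed otherwise. $\Gamma(k,q)=G_{\mathbb{F}_q}(k)=Cay(\mathbb{F}_q,\{x^k:x\in\mathbb{F}_q^*\})$ is the generalized Paley graph. A directed graph is connected if there is a directed walk between any ordered pair of vertices; $\delta$ is the diameter (the maximum over ordered pairs of vertices of the length of a shortest directed walk); $\gamma$ of a directed graph is its girth, the length of a shortest directed cycle. For $q=p^t$, $n\dagger q-1$ means that $n\mid p^t-1$ and $n\nmid p^a-1$ for all $1\le a<t$.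
   Formalization: δ(G_R(k))=g_R(k) is claimed only if k>1 or |m|=1, and the value 2 in (a) only if k>1; g_R(k)=g_{R'}(k) is claimed only if |m|=1⇔|m'|=1, or k=1, or G_R(k) is undirected with k'>1, or G_R(k) is directed with γ(Γ(k,q))≤g(k,q); in the other cases these claims fail. *)

(* Defs.v *)
From HB Require Import structures.
From mathcomp Require Import all_boot all_order all_algebra.

Set Implicit Arguments.
Unset Strict Implicit.
Unset Printing Implicit Defensive.

Import GRing.Theory.
Local Open Scope ring_scope.

(* An [idealr R] is proper by construction, so no condition J <> R is needed. *)
Definition maximal_ideal (R : finComUnitRingType) (I : idealr R) : Prop :=
  forall J : idealr R, {subset I <= J} -> I =i J.

Definition local_ring (R : finComUnitRingType) (m : idealr R) : Prop :=
  maximal_ideal m /\ forall I : idealr R, maximal_ideal I -> I =i m.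

Definition ring_iso (A B : nzRingType) : Prop :=
  exists f : {rmorphism A -> B}, bijective f.

Definition sums_of_kth_powers (A : pzRingType) (k s : nat) : Prop :=
  forall r : A, exists x : 'I_s -> A, \sum_(i < s) x i ^+ k = r.

(* "g_A(k) exists and equals s" *)
Definition is_waring (A : pzRingType) (k s : nat) : Prop :=
  sums_of_kth_powers A k s /\
  forall s', sums_of_kth_powers A k s' -> (s <= s')%N.

Definition Cay (A : finComUnitRingType) (S : {set A}) : rel A :=
  fun v w => w - v \in S.

Definition symmetric_set (A : finComUnitRingType) (S : {set A}) : Prop :=
  S = [set - x | x in S].

Definition unit_powers (A : finComUnitRingType) (k : nat) : {set A} :=
  [set x ^+ k | x : A & x \is a GRing.unit].

Definition nonzero_powers (A : finComUnitRingType) (k : nat) : {set A} :=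
  [set x ^+ k | x : A & x != 0].

Definition G (A : finComUnitRingType) (k : nat) : rel A :=
  Cay (unit_powers A k).

Definition W (A : finComUnitRingType) (k : nat) : rel A :=
  Cay (nonzero_powers A k).

Definition G_undirected (A : finComUnitRingType) (k : nat) : Prop :=
  symmetric_set (unit_powers A k).

Section Digraphs.
Variables (V : finType) (e : rel V).

Definition strongly_connected : Prop := forall v w : V, connect e v w.

Definition walk (v w : V) (n : nat) : Prop :=
  exists p : seq V, [/\ path e v p, last v p = w & size p = n].

Definition is_distance (v w : V) (n : nat) : Prop :=
  walk v w n /\ forall n', walk v w n' -> (n <= n')%N.

(* "the diameter is finite and equals d" *)
Definition is_diameter (d : nat) : Prop :=
  (forall v w, exists2 n, is_distance v w n & (n <= d)%N) /\
  (exists v w, is_distance v w d).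

Definition dicycle_of_length (n : nat) : Prop :=
  exists c : seq V, [/\ ucycle e c, size c = n & (0 < n)%N].

Definition is_girth (n : nat) : Prop :=
  dicycle_of_length n /\ forall n', dicycle_of_length n' -> (n <= n')%N.

End Digraphs.

(* n † p^t - 1 *)
Definition dagger (n p t : nat) : Prop :=
  (n %| (p ^ t).-1)%N /\
  forall a : nat, (1 <= a < t)%N -> ~~ (n %| (p ^ a).-1)%N.

(* Main.v *)
Require Import Defs.
From HB Require Import structures.
From mathcomp Require Import all_boot all_order all_algebra.
From mathcomp Require Import all_fingroup cyclic.

(** Everything is reduced to sums of generators. For a finite ring [A] and a
    subset [S], there is a walk of length [n] from [v] to [w] in [Cay S]
    exactly when [w - v] is a sum of [n] elements of [S]; hence the diameter
    is the least [d] such that sums of at most [d] elements of [S] cover [A]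
    ([least_cover]), and the girth is the least [n > 0] such that [0] is a sum
    of [n] elements of [S]. Since [0 ^+ k = 0], the Waring number is also a
    least cover, that of the powers of nonzero elements; so it is the diameter
    of [W].

    In a field [F] of order [q = p ^ t], the sums of [k]-th powers form a
    subring, of order [p ^ a], whose unit group contains the nonzero powers.
    These form a group of order [(q - 1) / gcd (k, q - 1)], and primitivity of
    this divisor forces [a = t] ([unit_powers_cover]): the Waring number [gF]
    of [F] exists.

    Let now [pi : R -> F] be the residue map of the local ring [R], with
    kernel [m]. As [k] is invertible in [F], raising to the power [k] permutes
    the principal units [1 + m], so the powers of units of [R] are exactly the
    elements lying over powers of units of [F] ([unit_powers_pi]). Therefore
    an element outside [m] is a sum of [n] unit powers if and only if its
    residue is, whereas a nonzero element of [m] requires a closed walk of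
    positive length in the Paley graph: if [m] is nonzero, the diameter of [G]
    is [maxn gF g], where [g] is the girth of the Paley graph.

    Powers of non-units do not improve on this when [1 < k]: they are in the
    square of [m], so by Nakayama's lemma they all lie in an ideal strictly
    smaller than [m]. An element of [m] outside that ideal must involve unit
    powers, hence at least [g] of them ([least_cover_lift]).

    The case distinctions of the theorem then compare [g] with [gF]. One
    always has [2 <= g], as [0] is not a unit power, and [g <= gF + 1], as
    [-1] is a sum of at most [gF] powers; moreover [g = 2] when [-1] is a
    power, that is, when [G] is undirected; and [gF = 1] if and only if [gcd
    (k, q - 1) = 1]. *)

Set Implicit Arguments.
Unset Strict Implicit.
Unset Printing Implicit Defensive.

Import GRing.Theory.
Local Open Scope nat_scope.

(** * Walks in Cayley graphs as sums of generators *)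

Section SumsOfGenerators.
Variable A : finComUnitRingType.
Implicit Types (S T : {set A}) (r x y : A).
Local Open Scope ring_scope.

Fixpoint nsum S n : {set A} :=
  if n is n'.+1 then [set x + y | x in S, y in nsum S n'] else [set 0].

Lemma nsum0 S r : (r \in nsum S 0) = (r == 0).
Proof. by rewrite inE. Qed.

Lemma nsumSP S n r :
  reflect (exists x y, [/\ x \in S, y \in nsum S n & r = x + y])
          (r \in nsum S n.+1).
Proof.
apply: (iffP imset2P) => [[x y Sx Sy ->]|[x [y [Sx Sy ->]]]].
  by exists x, y.
by exists x y.
Qed.

Lemma nsum1 S r : (r \in nsum S 1) = (r \in S).
Proof.
apply/nsumSP/idP => [[x [y [Sx]]]|Sr]; last first.
  by exists r, 0; rewrite nsum0 addr0.
by rewrite nsum0 => /eqP-> ->; rewrite addr0.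
Qed.

Lemma nsumD S a b x y :
  x \in nsum S a -> y \in nsum S b -> x + y \in nsum S (a + b)%N.
Proof.
elim: a x => [|a IHa] x; first by rewrite nsum0 => /eqP-> ?; rewrite add0r.
case/nsumSP => [u [v [Su Sv ->]]] Sy; rewrite -addrA addSn.
by apply/nsumSP; exists u, (v + y); split=> //; apply: IHa.
Qed.

Lemma sub_nsum S T n : S \subset T -> nsum S n \subset nsum T n.
Proof.
move=> /subsetP sST; elim: n => // n /subsetP IHn.
apply/subsetP => r /nsumSP[x [y [Sx Sy ->]]].
by apply/nsumSP; exists x, y; split; auto.
Qed.

Lemma walk_Cay S v w n : walk (Cay S) v w n <-> w - v \in nsum S n.
Proof.
elim: n v => [|n IHn] v.
  rewrite nsum0 subr_eq0; split=> [[p [_ <- /size0nil->]] //|/eqP->].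
  by exists [::].
split=> [[p [vp lp sp]]|/nsumSP[x [y [Sx Sy def_wv]]]].
  case: p vp lp sp => //= u p /andP[vu up] lp [sp].
  apply/nsumSP; exists (u - v), (w - u); split=> //.
    by apply/IHn; exists p.
  by rewrite [RHS]addrC addrA subrK.
have: w - (v + x) \in nsum S n by rewrite opprD addrA def_wv addrC addKr.
case/IHn=> p [vp lp sp]; exists (v + x :: p); split=> //=; last by rewrite sp.
by rewrite vp andbT /Cay addrC addKr.
Qed.

(** A boolean, so that a least [d] exists as soon as some [d] does: Waring
    numbers and diameters are obtained as such minima. *)
Definition covers S d :=
  [forall r, [exists n : 'I_d.+1, r \in nsum S n]].

Lemma coversP S d :
  reflect (forall r, exists2 n, (n <= d)%N & r \in nsum S n) (covers S d).
Proof.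
apply: (iffP forallP) => cov r; have := cov r.
  by case/existsP=> n Sr; exists n => //; rewrite -ltnS ltn_ord.
by case=> n le_nd Sr; apply/existsP; exists (Ordinal (le_nd : n < d.+1)%N).
Qed.

Definition least_cover S d :=
  covers S d /\ forall d', covers S d' -> (d <= d')%N.

Lemma least_cover_exists S d : covers S d -> exists g, least_cover S g.
Proof.
move=> cov; have ex_cov : exists d, covers S d by exists d.
by case: (ex_minnP ex_cov) => g; exists g.
Qed.

Lemma least_cover_inj S d d' : least_cover S d -> least_cover S d' -> d = d'.
Proof.
by move=> [cd min_d] [cd' min_d']; apply/eqP; rewrite eqn_leq min_d ?min_d'.
Qed.

Lemma covers0F S : covers S 0 = false.
Proof.
apply/negP => /coversP/(_ 1)[[|//] _]; rewrite nsum0.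
by rewrite (negPf (oner_neq0 _)).
Qed.

Lemma least_cover_gt0 S d : least_cover S d -> (0 < d)%N.
Proof. by case: d => // -[]; rewrite covers0F. Qed.

Lemma sub_covers S T d : S \subset T -> covers S d -> covers T d.
Proof.
move=> sST /coversP cov; apply/coversP => r; have [n le_nd Sr] := cov r.
by exists n; rewrite // (subsetP (sub_nsum n sST)).
Qed.

Lemma is_distance_ex S v w n :
  w - v \in nsum S n -> exists2 m, is_distance (Cay S) v w m & (m <= n)%N.
Proof.
move=> Sn; have ex_n : exists n, w - v \in nsum S n by exists n.
case: (ex_minnP ex_n) => m Sm min_m; exists m; last exact: min_m.
by split=> [|n' /walk_Cay]; [apply/walk_Cay | apply: min_m].
Qed.

(** Translations act transitively on a Cayley graph, so distances from [0]
    already determine the diameter; if no element were at distance exactly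
    [d] from [0], one could cover with [d.-1] generators. *)
Lemma least_cover_diameter S d : least_cover S d -> is_diameter (Cay S) d.
Proof.
move=> lc; have d_gt0 := least_cover_gt0 lc; case: lc => /coversP cov min_d.
have dist v w : exists2 n, is_distance (Cay S) v w n & (n <= d)%N.
  have [n le_nd Sn] := cov (w - v); have [m dm le_mn] := is_distance_ex Sn.
  by exists m; rewrite // (leq_trans le_mn).
split=> //.
have: ~~ covers S d.-1 by apply/negP => /min_d; rewrite leqNgt prednK ?leqnn.
case/forallPn=> r /existsPn notSr; exists 0, r.
have [n dn le_nd] := dist 0 r; suff -> : d = n by [].
apply/eqP; rewrite eqn_leq le_nd andbT leqNgt; apply/negP => lt_nd.
case: dn => /walk_Cay; rewrite subr0 => Sr _.
have lt_n : (n < d.-1.+1)%N by rewrite prednK.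
by have /negP[] := notSr (Ordinal lt_n).
Qed.

Lemma covers_connected S d : covers S d -> strongly_connected (Cay S).
Proof.
move=> /coversP cov v w; have [n _ /walk_Cay[p [vp <- _]]] := cov (w - v).
by apply/connectP; exists p.
Qed.

End SumsOfGenerators.

Section Girth.
Variables (A : finComUnitRingType) (S : {set A}).
Local Open Scope ring_scope.

Lemma dicycle_nsum n :
  dicycle_of_length (Cay S) n -> (0 < n)%N /\ 0 \in nsum S n.
Proof.
case=> -[|x p] [/andP[cyc _] <- // _]; split=> //.
rewrite -(subrr x); apply/walk_Cay; exists (rcons p x).
by rewrite last_rcons size_rcons.
Qed.

(** Removing the loops from a closed walk, its first arc being kept apart,
    leaves a directed cycle. *)
Lemma nsum_dicycle n : (0 < n)%N -> 0 \in nsum S n ->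
  exists2 n', dicycle_of_length (Cay S) n' & (n' <= n)%N.
Proof.
case: n => // n _ sum0; have: walk (Cay S) 0 0 n.+1.
  by apply/walk_Cay; rewrite subrr.
case=> -[|v p] [//= /andP[e0v vp] lp [<-]].
case: {vp}(shortenP vp) lp => q vq uq sub_qp lq.
exists (size q).+1; last first.
  by rewrite ltnS; apply: uniq_leq_size sub_qp; case/andP: uq.
exists (v :: q); split=> //; apply/andP; split=> //=.
by rewrite rcons_path vq lq.
Qed.

Lemma girth_Cay g : is_girth (Cay S) g <->
  [/\ (0 < g)%N, 0 \in nsum S g &
      forall n, (0 < n)%N -> 0 \in nsum S n -> (g <= n)%N].
Proof.
split=> [[/dicycle_nsum[g0 Sg] min_g]|[g0 Sg min_g]].
  split=> // n n0 Sn; have [n' cyc le_n'n] := nsum_dicycle n0 Sn.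
  exact: leq_trans (min_g _ cyc) le_n'n.
split; last by move=> n /dicycle_nsum[]; apply: min_g.
have [n cyc le_ng] := nsum_dicycle g0 Sg.
suff -> : g = n by [].
by have [n0 Sn] := dicycle_nsum cyc; apply/eqP; rewrite eqn_leq le_ng min_g.
Qed.

Lemma girth_exists n :
  (0 < n)%N -> 0 \in nsum S n -> exists g, is_girth (Cay S) g.
Proof.
move=> n0 Sn.
have ex_n : exists n, (0 < n)%N && (0 \in nsum S n) by exists n; rewrite n0.
case: (ex_minnP ex_n) => g /andP[g0 Sg] min_g; exists g; apply/girth_Cay.
by split=> // n' n'0 Sn'; apply: min_g; rewrite n'0.
Qed.

End Girth.

(** * Waring numbers as least covers *)

Section Waring.
Variables (A : finComUnitRingType) (k : nat).
Hypothesis k_gt0 : 0 < k.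
Local Open Scope ring_scope.

Lemma expr0k : 0 ^+ k = 0 :> A.
Proof. by rewrite expr0n eqn0Ngt k_gt0. Qed.

Lemma mem_nonzero_powers (x : A) :
  x != 0 -> x ^+ k \in nonzero_powers A k.
Proof. by move=> x0; apply: imset_f; rewrite inE. Qed.

Lemma mem_unit_powers (x : A) :
  x \is a GRing.unit -> x ^+ k \in unit_powers A k.
Proof. by move=> x0; apply: imset_f; rewrite inE. Qed.

Lemma sub_unit_nonzero_powers : unit_powers A k \subset nonzero_powers A k.
Proof.
apply/subsetP => _ /imsetP[x + ->]; rewrite inE => ux.
by apply: mem_nonzero_powers; apply: contraTneq ux => ->; rewrite unitr0.
Qed.

(** Since [0 ^+ k = 0], sums of exactly [s] powers are sums of at most [s]
    powers of nonzero elements. *)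
Lemma sums_of_kth_powersP s :
  sums_of_kth_powers A k s <-> covers (nonzero_powers A k) s.
Proof.
split=> [sums|/coversP cov r].
  apply/coversP => r; have [x <-] := sums r => {sums}.
  elim: s x => [|s IHs] x.
    by exists 0%N; rewrite // big_ord0 nsum0.
  rewrite big_ord_recl; have [n le_ns Sn] := IHs (fun i => x (lift ord0 i)).
  have [x00|x0] := eqVneq (x ord0) 0.
    by exists n; [rewrite leqW | rewrite x00 expr0k add0r].
  exists n.+1 => //; apply/nsumSP.
  exists (x ord0 ^+ k), (\sum_i x (lift ord0 i) ^+ k).
  by rewrite mem_nonzero_powers.
have [n le_ns Sn] := cov r; clear cov.
suff [x sum_x] : exists x : nat -> A, \sum_(i < s) x i ^+ k = r.
  by exists (fun i => x i).
elim: n s r le_ns Sn => [|n IHn] s r.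
  move=> _; rewrite nsum0 => /eqP->; exists (fun=> 0).
  by rewrite big1 // => i _; rewrite expr0k.
case: s => // s le_ns /nsumSP[_ [y [/imsetP[a _ ->] Sy ->]]].
have [x <-] := IHn s y le_ns Sy.
exists (fun i => if i is i'.+1 then x i' else a).
by rewrite big_ord_recl.
Qed.

Lemma is_waringP g : is_waring A k g <-> least_cover (nonzero_powers A k) g.
Proof.
split=> -[/sums_of_kth_powersP sums min_g]; split=> // s.
  by move/sums_of_kth_powersP; apply: min_g.
by move/sums_of_kth_powersP; apply: min_g.
Qed.

End Waring.

Lemma unit_powers_field (F : finFieldType) k :
  unit_powers F k = nonzero_powers F k.
Proof.
by apply/setP=> y; apply/imsetP/imsetP => -[x]; rewrite inE => x0 ->;
  exists x => //; rewrite inE unitfE in x0 *.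
Qed.

(** * Ideals of a finite local ring *)

Section Ideals.
Variable A : finComUnitRingType.
Implicit Types I J : {set A}.
Local Open Scope ring_scope.

Definition ideal_set I :=
  (0 \in I) && [forall a, forall x in I, forall y in I, a * x + y \in I].

Lemma ideal_setP I :
  reflect (0 \in I /\ forall a x y, x \in I -> y \in I -> a * x + y \in I)
          (ideal_set I).
Proof.
apply: (iffP andP) => -[I0 closI]; split=> //.
  move=> a x y Ix Iy; move/forallP/(_ a)/forall_inP/(_ x Ix): closI.
  by move/forall_inP/(_ y Iy).
apply/forallP=> a; apply/forall_inP=> x Ix; apply/forall_inP=> y Iy.
exact: closI.
Qed.

Lemma ideal_setD I x y : ideal_set I -> x \in I -> y \in I -> x + y \in I.
Proof. by case/ideal_setP=> _ /(_ 1 x y); rewrite mul1r. Qed.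

Lemma ideal_setMl I a x : ideal_set I -> x \in I -> a * x \in I.
Proof. by case/ideal_setP=> I0 /(_ a x 0) clos /clos/(_ I0); rewrite addr0. Qed.

Lemma ideal_set0 : ideal_set [set 0].
Proof.
apply/ideal_setP; split=> [|a x y]; rewrite !inE // => /eqP-> /eqP->.
by rewrite mulr0 addr0.
Qed.

Definition ideal_adjoin I a : {set A} := [set x + b * a | x in I, b in A].

Lemma ideal_adjoinP I a y :
  reflect (exists x b, x \in I /\ y = x + b * a) (y \in ideal_adjoin I a).
Proof.
apply: (iffP imset2P) => [[x b Ix _ ->]|[x [b [Ix ->]]]]; first by exists x, b.
by exists x b.
Qed.

Lemma ideal_set_adjoin I a : ideal_set I -> ideal_set (ideal_adjoin I a).
Proof.
move=> idI; have [I0 closI] := ideal_setP _ idI; apply/ideal_setP; split.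
  by apply/ideal_adjoinP; exists 0, 0; rewrite mul0r addr0.
move=> c _ _ /ideal_adjoinP[x [b [Ix ->]]] /ideal_adjoinP[y [d [Iy ->]]].
apply/ideal_adjoinP; exists (c * x + y), (c * b + d); split; first exact: closI.
by rewrite mulrDr mulrDl !mulrA addrACA.
Qed.

Lemma sub_ideal_adjoin I a : I \subset ideal_adjoin I a.
Proof.
by apply/subsetP=> x Ix; apply/ideal_adjoinP; exists x, 0; rewrite mul0r addr0.
Qed.

Lemma mem_ideal_adjoin I a : ideal_set I -> a \in ideal_adjoin I a.
Proof.
case/ideal_setP=> I0 _; apply/ideal_adjoinP; exists 0, 1.
by rewrite mul1r add0r.
Qed.

Lemma ideal_set_idealr (J : idealr A) : ideal_set [set x in J].
Proof.
apply/ideal_setP; split=> [|a x y]; rewrite !inE ?rpred0 // => Jx Jy.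
by apply: rpredD; first apply: idealMr.
Qed.

Lemma idealr_of_set I :
  ideal_set I -> 1 \notin I -> exists J : idealr A, J =i I.
Proof.
case/ideal_setP=> I0 closI nI1.
have closP : idealr_closed (fun x => x \in I) by split.
pose J : idealr A := HB.pack (fun x => x \in I) (isIdealr.Build A _ closP).
by exists J.
Qed.

(** A non-unit generates a proper ideal, hence lies in a maximal one, and [m]
    is the only maximal ideal. *)
Lemma local_unit (m : idealr A) x :
  local_ring m -> x \notin m -> x \is a GRing.unit.
Proof.
move=> [_ uniq_m]; apply: contraR => nUx.
pose proper I := ideal_set I && (1 \notin I).
have [|I /maxsetP[/andP[idI nI1] maxI] sub_xI] :=
    @maxset_exists _ proper (ideal_adjoin [set 0] x).
  rewrite /proper ideal_set_adjoin ?ideal_set0 //.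
  apply: contra nUx => /ideal_adjoinP[_ [b [/set1P-> def1]]].
  by apply/unitrP; exists b; rewrite [x * b]mulrC def1 add0r.
have [J defJ] := idealr_of_set idI nI1.
have maxJ : maximal_ideal J.
  move=> J' sJJ' y; rewrite defJ -(maxI [set z in J']) ?inE //.
    by rewrite /proper ideal_set_idealr inE idealr1.
  by apply/subsetP => z; rewrite inE -defJ; apply: sJJ'.
rewrite -(uniq_m J maxJ) defJ (subsetP sub_xI) //.
by rewrite mem_ideal_adjoin // ideal_set0.
Qed.

(** Nakayama's lemma for the square of an ideal [M] inside the Jacobson
    radical. Take [I] maximal among the ideals strictly below [M]. For [a] in
    [M] outside [I], maximality gives [M = I + A a], so it is enough that [y *
    a] is in [I] for [y] in [M]; otherwise also [M = I + A (y * a)], so that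
    [a - b y a] is in [I] for some [b], and [1 - b y] being a unit, so is [a]. *)
Lemma nakayama_square (M : {set A}) :
    ideal_set M -> M != [set 0] ->
    {in M, forall x, 1 - x \is a GRing.unit} ->
  exists I, [/\ ideal_set I, I \proper M &
                {in M &, forall x y, x * y \in I}].
Proof.
move=> idM M_n0 unitM; pose below I := ideal_set I && (I \proper M).
have [|I /maxsetP[/andP[idI ltIM] maxI] _] := @maxset_exists _ below [set 0].
  rewrite /below ideal_set0 properEneq eq_sym M_n0 sub1set.
  by case/ideal_setP: idM.
exists I; split=> //; have /properP[sIM [a Ma nIa]] := ltIM.
have fill c : c \in M -> c \notin I -> {subset M <= ideal_adjoin I c}.
  move=> Mc nIc z Mz; apply: contraNT nIc => nz.
  rewrite -(maxI (ideal_adjoin I c)) ?mem_ideal_adjoin ?sub_ideal_adjoin //.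
  rewrite /below ideal_set_adjoin //=; apply/properP; split; last by exists z.
  apply/subsetP=> _ /ideal_adjoinP[x [b [Ix ->]]].
  by rewrite ideal_setD ?ideal_setMl // (subsetP sIM).
have Iya y : y \in M -> y * a \in I.
  move=> My; apply: contraR nIa => nIya.
  have /ideal_adjoinP[x [b [Ix def_a]]] :=
    fill _ (ideal_setMl y idM Ma) nIya a Ma.
  have u_by := unitM _ (ideal_setMl b idM My).
  suff -> : a = (1 - b * y)^-1 * x by apply: ideal_setMl.
  apply: (canRL (mulKr u_by)).
  by rewrite mulrBl mul1r {1}def_a mulrA addrK.
move=> x y Mx My; have /ideal_adjoinP[z [b [Iz ->]]] := fill a Ma nIa x Mx.
rewrite mulrDl ideal_setD //; first by rewrite mulrC ideal_setMl.
by rewrite mulrAC -mulrA ideal_setMl // Iya.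
Qed.

End Ideals.

Section ResidueMap.
Variables (R : finComUnitRingType) (m : idealr R) (F : finFieldType).
Local Open Scope ring_scope.
Local Open Scope quotient_scope.

Lemma residue_map : ring_iso {ideal_quot m} F ->
  exists pi : {rmorphism R -> F},
    (forall y, exists x, pi x = y) /\ (forall x, (x \in m) = (pi x == 0)).
Proof.
case=> f [g fK gK].
exists (f \o \pi_{ideal_quot m}); split=> [y|x] /=.
  by exists (generic_quotient.repr (g y)); rewrite reprK gK.
rewrite -(rmorph0 f) (can_eq fK) -(rmorph0 (\pi_{ideal_quot m})).
by rewrite -Quotient.idealrBE subr0.
Qed.

End ResidueMap.

(** * Powers in a finite field *)

Section Field.
Variables (F : finFieldType) (k : nat).
Local Open Scope ring_scope.
Local Notation q := #|F|.
Local Notation U := (unit_powers F k).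

Lemma unit_powers_cyclic : exists2 u : {unit F},
  #[u]%g = (q.-1 %/ gcdn k q.-1)%N & U = [set val v | v in <[u]>%g].
Proof.
have /cyclicP[g def_g] := field_unit_group_cyclic [set: {unit F}]%G.
have og : #[g]%g = q.-1 by rewrite /order -def_g card_finField_unit.
exists (g ^+ k)%g; first by rewrite orderXgcd og gcdnC.
apply/setP=> y; apply/imsetP/imsetP => -[x].
  rewrite inE => ux ->.
  have : FinRing.unit F ux \in <[g]>%g by rewrite -def_g inE.
  case/cycleP=> i def_x; exists ((g ^+ k) ^+ i)%g; first exact: mem_cycle.
  by rewrite -expgM mulnC expgM -def_x FinRing.val_unitX.
case/cycleP=> i -> ->; exists (val (g ^+ i)%g).
  by rewrite inE (valP (g ^+ i)%g).
by rewrite -FinRing.val_unitX -!expgM mulnC.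
Qed.

Lemma card_unit_powers : #|U| = (q.-1 %/ gcdn k q.-1)%N.
Proof.
by have [u <- ->] := unit_powers_cyclic; rewrite card_imset //; apply: val_inj.
Qed.

Lemma unit_powers_n0 x : x \in U -> x != 0.
Proof. by case/imsetP=> y; rewrite inE -unitfE => uy ->; rewrite unitrX. Qed.

Lemma unit_powers_all :
  (0 < k)%N -> (gcdn k q.-1 == 1)%N = (U == [set~ 0]).
Proof.
move=> k0; have q0 : (0 < q.-1)%N by rewrite -subn1 subn_gt0 card_finNzRing_gt1.
have sU : U \subset [set~ 0].
  by apply/subsetP=> x /unit_powers_n0; rewrite !inE.
rewrite eqEcard sU cardsC1 card_unit_powers /=.
have k'0 : (0 < gcdn k q.-1)%N by rewrite gcdn_gt0 k0.
apply/eqP/idP => [->|]; first by rewrite divn1.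
rewrite leqNgt ltn_divLR // -leqNgt => le_q; apply/eqP.
rewrite eqn_leq k'0 andbT -(leq_pmul2l q0) muln1 //.
Qed.

(** The sums of [k]-th powers form a subring, thus of order [p ^ a] for some
    [a]; its units contain the nonzero [k]-th powers, a group of order
    [(q - 1) / gcd (k, q - 1)].  By primitivity of that divisor, [a = t]. *)
Lemma unit_powers_cover p t :
    (0 < k)%N -> p \in [pchar F] -> q = (p ^ t)%N ->
    dagger (q.-1 %/ gcdn k q.-1) p t ->
  exists d, covers U d.
Proof.
move=> k0 charF qE [_ prim].
have p_pr : prime p := pcharf_prime charF.
pose K := [set r | connect (Cay U) 0 r].
have KP r : reflect (exists n, r \in nsum U n) (r \in K).
  rewrite inE; apply: (iffP connectP) => [[s path_s ->]|[n Sn]].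
    by exists (size s); rewrite -[last _ _]subr0; apply/walk_Cay; exists s.
  have /walk_Cay[s [? <- _]] : r - 0 \in nsum U n by rewrite subr0.
  by exists s.
clearbody K; have KD x y : x \in K -> y \in K -> x + y \in K.
  move=> /KP[a Sx] /KP[b Sy]; apply/KP; exists (a + b)%N; exact: nsumD.
have K0 : 0 \in K by apply/KP; exists 0%N; rewrite nsum0.
have UK x : x \in U -> x \in K.
  by move=> Ux; apply/KP; exists 1%N; rewrite nsum1.
have UM x y : x \in U -> y \in U -> x * y \in U.
  move=> /imsetP[a]; rewrite inE => ua -> /imsetP[b]; rewrite inE => ub ->.
  by rewrite -exprMn mem_unit_powers // unitrM ua.
have UKM x y : x \in U -> y \in K -> x * y \in K.
  move=> Ux /KP[n]; elim: n y => [|n IHn] y.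
    by rewrite nsum0 => /eqP->; rewrite mulr0.
  case/nsumSP=> u [v [Uu /IHn Kv ->]]; rewrite mulrDr KD //.
  by rewrite UK ?UM.
have KM x y : x \in K -> y \in K -> x * y \in K.
  move=> /KP[n]; elim: n x => [|n IHn] x.
    by rewrite nsum0 => /eqP->; rewrite mul0r.
  case/nsumSP=> u [v [Uu Sv ->]] Ky; rewrite mulrDl KD //.
    exact: UKM.
  exact: IHn.
have K1 : 1 \in K by rewrite UK // -(expr1n _ k) mem_unit_powers ?unitr1.
(* A nonempty subset of a finite group closed under the law is a subgroup. *)
have gK : @group_set F K by apply/group_setP; split.
have [a le_at cardK] : exists2 a, (a <= t)%N & #|K| = (p ^ a)%N.
  apply/dvdn_pfactor => //; rewrite -qE -cardsT.
  by have dvdK := cardSg (subsetT (Group gK)); exact: dvdK.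
have a0 : (0 < a)%N.
  rewrite lt0n; apply: contraTneq (oner_neq0 F) => a0.
  have /cards1P[z defK] : #|K| == 1%N by rewrite cardK a0.
  by move: K0 K1; rewrite defK !inE => /eqP-> /eqP->; rewrite eqxx.
have gV : group_set [set v : {unit F} | val v \in K].
  apply/group_setP; split=> [|v w]; rewrite !inE //; exact: KM.
have cardV : #|Group gV| = (p ^ a).-1.
  rewrite -cardK (cardsD1 0 K) K0 /= -(card_imset _ val_inj).
  apply: eq_card => x; apply/imsetP/idP => [[v + ->]|].
    rewrite !inE => ->; rewrite andbT -unitfE; exact: valP.
  rewrite !inE => /andP[]; rewrite -unitfE => ux Kx.
  by exists (FinRing.unit F ux); rewrite ?inE.
have [u ou defU] := unit_powers_cyclic.
have div_a : (q.-1 %/ gcdn k q.-1 %| (p ^ a).-1)%N.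
  rewrite -ou -cardV; apply: cardSg; rewrite cycle_subG inE UK // defU.
  by apply: imset_f; apply: cycle_id.
have eq_at : a = t.
  apply/eqP; rewrite eqn_leq le_at leqNgt; apply/negP => lt_at.
  by have := prim a; rewrite a0 lt_at div_a => /(_ isT).
have KT : K = [set: F].
  by apply/eqP; rewrite eqEcard subsetT cardsT cardK eq_at qE leqnn.
have bound r : exists n : nat, r \in nsum U n by apply/KP; rewrite KT inE.
have [f fP] := fin_all_exists bound.
exists (\max_r f r); apply/coversP=> r; exists (f r) => //.
exact: leq_bigmax.
Qed.

End Field.

(** * Lifting sums of powers from the residue field *)

Section Lifting.
Variables (R : finComUnitRingType) (F : finFieldType) (pi : {rmorphism R -> F}).
Variable k : nat.
Local Open Scope ring_scope.
Local Notation M := [set x | pi x == 0].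
Local Notation UR := (unit_powers R k).
Local Notation UF := (unit_powers F k).
Local Notation PR := (nonzero_powers R k).

Hypothesis pi_surj : forall y, exists x, pi x = y.
Hypothesis pi_unit : forall x, pi x != 0 -> x \is a GRing.unit.
Hypothesis k_n0 : k%:R != 0 :> F.

Let k_gt0 : (0 < k)%N.
Proof. by rewrite lt0n; apply: contraNneq k_n0 => ->. Qed.

(** For [pi x = pi y = 1] one has [x ^+ k - y ^+ k = (x - y) * \sum_i x ^+
    (k.-1 - i) * y ^+ i], where the sum is a unit, being congruent to [k]. So
    [x |-> x ^+ k] is injective on the finite group of principal units, hence
    surjective. *)
Lemma principal_unit_power u : pi u = 1 -> exists2 w, pi w = 1 & u = w ^+ k.
Proof.
move=> pu; pose W := [set w | pi w == 1].
have injW : {in W &, injective (fun w => w ^+ k)}.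
  move=> x y; rewrite !inE => /eqP px /eqP py eq_xy.
  have /esym/eqP := subrXX x y k; rewrite eq_xy subrr => /eqP xy0.
  have us : \sum_(i < k) x ^+ (k.-1 - i) * y ^+ i \is a GRing.unit.
    apply: pi_unit; rewrite rmorph_sum (eq_bigr (fun=> 1)) => [|i _].
      by rewrite sumr_const card_ord.
    by rewrite rmorphM !rmorphXn px py !expr1n mulr1.
  by apply/eqP; rewrite -subr_eq0 -[x - y](mulrK us) xy0 mul0r.
have defW : [set w ^+ k | w in W] = W.
  apply/eqP; rewrite eqEcard (card_in_imset injW) leqnn andbT.
  apply/subsetP=> _ /imsetP[w + ->]; rewrite !inE => /eqP pw.
  by rewrite rmorphXn pw expr1n.
have /imsetP[w] : u \in [set w ^+ k | w in W] by rewrite defW inE pu.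
by rewrite inE => /eqP; exists w.
Qed.

Lemma unit_powers_pi x : (x \in UR) = (pi x \in UF).
Proof.
apply/idP/idP => [/imsetP[y]|/imsetP[y]]; rewrite inE.
  by move=> uy ->; rewrite rmorphXn mem_unit_powers ?rmorph_unit.
rewrite unitfE; have [z <-] := pi_surj y => /pi_unit uz px.
have puz : pi z ^+ k \is a GRing.unit by rewrite unitrX ?rmorph_unit.
have [|w pw def_w] := @principal_unit_power (x / z ^+ k).
  by rewrite rmorphM rmorphV ?unitrX // rmorphXn px divrr.
have uw : w \is a GRing.unit by rewrite pi_unit // pw oner_neq0.
rewrite -[x](divrK (unitrX k uz)) def_w -exprMn mem_unit_powers //.
by rewrite unitrM uw.
Qed.

(** The number of summands has to be positive: an empty sum is [0], whereas
    [pi r = 0] only says that [r] is in the maximal ideal. *)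
Lemma nsum_pi n r : (r \in nsum UR n.+1) = (pi r \in nsum UF n.+1).
Proof.
elim: n r => [|n IHn] r; first by rewrite !nsum1 unit_powers_pi.
apply/nsumSP/nsumSP => -[x [y [Ux Sy def_r]]].
  exists (pi x), (pi y).
  by rewrite -unit_powers_pi -IHn def_r rmorphD.
have [a def_x] := pi_surj x; exists a, (r - a); split.
- by rewrite unit_powers_pi def_x.
- by rewrite IHn rmorphB def_r def_x addrAC subrr add0r.
- by rewrite addrC subrK.
Qed.

(** Discarding the summands that vanish modulo the maximal ideal. *)
Lemma nsum_nonzero_powers_pi (I : {set R}) n r :
    ideal_set I -> {in M, forall x, x ^+ k \in I} -> r \in nsum PR n ->
  exists n', [/\ (n' <= n)%N, pi r \in nsum UF n' & n' = 0%N -> r \in I].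
Proof.
move=> idI IM; elim: n r => [|n IHn] r.
  rewrite nsum0 => /eqP->; exists 0%N; rewrite nsum0 rmorph0.
  by split=> // _; case/ideal_setP: idI.
case/nsumSP=> _ [y [/imsetP[x _ ->] /IHn[n' [le_n'n Sy Iy]] ->]].
have [px0|px0] := eqVneq (pi x) 0.
  exists n'; split=> [||n'0]; first exact: leqW.
    by rewrite rmorphD rmorphXn px0 expr0k // add0r.
  by rewrite ideal_setD ?Iy // IM // inE px0.
exists n'.+1; split=> //; apply/nsumSP; exists (pi x ^+ k), (pi y).
by rewrite rmorphD rmorphXn mem_unit_powers ?unitfE.
Qed.

Lemma covers_pi d : covers PR d -> covers UF d.
Proof.
move=> /coversP cov; apply/coversP=> y; have [r <-] := pi_surj y.
have [n le_nd Sr] := cov r.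
have idT : ideal_set [set: R] by apply/ideal_setP; split=> *; rewrite inE.
have [|n' [le_n'n Sn' _]] := nsum_nonzero_powers_pi idT _ Sr.
  by move=> x _; rewrite inE.
by exists n'; rewrite // (leq_trans le_n'n).
Qed.

Lemma least_cover_lift_inj gF : M = [set 0] -> least_cover UF gF ->
  least_cover PR gF /\ least_cover UR gF.
Proof.
move=> M0 [/coversP covF min_gF].
have injpi x : (pi x == 0) = (x == 0).
  by have := in_set1 x 0; rewrite -M0 inE.
have min_PR d : covers PR d -> (gF <= d)%N by move/covers_pi/min_gF.
have covR : covers UR gF.
  apply/coversP=> r; have [n le_n Sr] := covF (pi r); exists n => //.
  by case: n {le_n} Sr => [|n]; rewrite ?nsum_pi // !nsum0 injpi.
have sUP := sub_unit_nonzero_powers R k.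
split; split=> //; first exact: sub_covers covR.
by move=> d /(sub_covers sUP)/min_PR.
Qed.

Lemma kernel_ideal : ideal_set M.
Proof.
apply/ideal_setP; split=> [|a x y]; rewrite !inE ?rmorph0 //.
by move=> /eqP px /eqP py; rewrite rmorphD rmorphM px py mulr0 addr0.
Qed.

(** Elements outside the maximal ideal behave as in the residue field, and a
    nonzero element of it is a sum of unit powers along a closed walk of the
    Paley graph: whence the maximum.  Powers of non-units do not help: when
    [1 < k] they are in the square of the maximal ideal, which by Nakayama's
    lemma misses some element. *)
Lemma least_cover_lift gF g :
    (1 < k)%N -> M != [set 0] -> least_cover UF gF -> is_girth (@G F k) g ->
  least_cover PR (maxn gF g) /\ least_cover UR (maxn gF g).
Proof.
move=> k_gt1 M_n0 [/coversP covF min_gF] /girth_Cay[g0 Sg min_g].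
have covR : covers UR (maxn gF g).
  apply/coversP=> r; have [[|n] le_n Sr] := covF (pi r).
    exists g; first exact: leq_maxr.
    move: Sr Sg; rewrite nsum0 => /eqP pr0.
    by case: (g) g0 => // h _; rewrite nsum_pi pr0.
  by exists n.+1; rewrite ?nsum_pi // leq_max le_n.
have unitM : {in M, forall x, 1 - x \is a GRing.unit}.
  move=> x; rewrite inE => /eqP px0.
  by rewrite pi_unit // rmorphB rmorph1 px0 subr0 oner_neq0.
have [I [idI ltIM IMM]] := nakayama_square kernel_ideal M_n0 unitM.
have IM : {in M, forall x, x ^+ k \in I}.
  move=> x Mx; rewrite -(subnK k_gt1) exprD ideal_setMl //.
  by rewrite expr2 IMM.
have /properP[_ [z Mz nIz]] := ltIM.
have min_PR d : covers PR d -> (maxn gF g <= d)%N.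
  move=> cov; rewrite geq_max min_gF ?covers_pi //=.
  have /coversP/(_ z)[n le_nd Sz] := cov.
  have [n' [le_n'n Sn' In']] := nsum_nonzero_powers_pi idI IM Sz.
  case: n' le_n'n Sn' In' => [|n'] le_n'n Sn' In'; first by rewrite In' in nIz.
  apply: leq_trans (leq_trans le_n'n le_nd); apply: min_g => //.
  by move: Mz Sn'; rewrite inE => /eqP->.
have sUP := sub_unit_nonzero_powers R k.
split; split=> //; first exact: sub_covers covR.
by move=> d /(sub_covers sUP)/min_PR.
Qed.

End Lifting.

Lemma least_cover1 (A : finComUnitRingType) :
  least_cover (nonzero_powers A 1) 1.
Proof.
split=> [|[|d]]; rewrite ?covers0F //; apply/coversP=> r.
have [->|r0] := eqVneq r 0%R; first by exists 0; rewrite ?nsum0.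
by exists 1; rewrite // nsum1 -[r]expr1 mem_nonzero_powers.
Qed.

Section FieldInvariants.
Variables (F : finFieldType) (k gF g : nat).
Hypotheses (k_gt0 : 0 < k) (waring_F : least_cover (unit_powers F k) gF).
Hypothesis girth_F : is_girth (@G F k) g.
Local Open Scope ring_scope.
Local Notation U := (unit_powers F k).
Local Notation k' := (gcdn k #|F|.-1).

Lemma unit_powers1 : 1 \in U.
Proof. by rewrite -(expr1n F k) mem_unit_powers ?unitr1. Qed.

Lemma girth_ge2 : (2 <= g)%N.
Proof.
case/girth_Cay: girth_F => g0 Sg _; rewrite ltn_neqAle g0 andbT.
apply: contraTneq Sg => <-; rewrite nsum1.
by apply/negP => /unit_powers_n0/eqP.
Qed.

Lemma girth_le2 : -1 \in U -> (g <= 2)%N.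
Proof.
move=> UN1; case/girth_Cay: girth_F => _ _; apply=> //.
by rewrite -(subrr 1); apply: (@nsumD _ _ 1 1); rewrite nsum1 ?unit_powers1.
Qed.

(** The arc [1] followed by a walk of length at most [gF] representing [-1] is
    a closed walk. *)
Lemma girth_leS : (g <= gF.+1)%N.
Proof.
case: waring_F => /coversP/(_ (-1))[n le_n SN1] _.
case/girth_Cay: girth_F => _ _ min_g; apply: (@leq_trans n.+1) => //.
apply: min_g => //; rewrite -(subrr 1).
by apply: (@nsumD _ _ 1); rewrite ?nsum1 ?unit_powers1.
Qed.

Lemma waring_field_eq1 : (gF == 1)%N = (k' == 1)%N.
Proof.
rewrite unit_powers_all //; apply/eqP/eqP => [gF1|defU].
  case: waring_F => /coversP cov _; apply/setP=> r; rewrite !inE.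
  apply/idP/idP => [/unit_powers_n0 //|r0].
  have [n] := cov r; rewrite gF1; case: n => [|[|//]] _.
    by rewrite nsum0 (negPf r0).
  by rewrite nsum1.
apply/eqP; rewrite eqn_leq (least_cover_gt0 waring_F) andbT.
case: waring_F => _; apply; apply/coversP=> r.
have [->|r0] := eqVneq r 0; first by exists 0%N; rewrite ?nsum0.
by exists 1%N; rewrite // nsum1 defU !inE.
Qed.

End FieldInvariants.

(** * Finite local rings *)

(** For [k = 1] the girth gives no lower bound, since the powers of non-units
    fill the maximal ideal; when [cardm = 1] there is no nonzero non-unit to
    represent. *)
Definition local_waring (k cardm gF g : nat) : nat :=
  if (k == 1) || (cardm == 1) then gF else maxn gF g.

Section LocalRing.
Variables (R : finComUnitRingType) (m : idealr R) (F : finFieldType).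
Variables k gF g : nat.
Hypotheses (R_local : local_ring m) (residue : ring_iso {ideal_quot m} F).
Hypothesis k_n0 : (k%:R != 0 :> F)%R.

Lemma local_residue_map : exists pi : {rmorphism R -> F},
  [/\ forall y, exists x, pi x = y,
      forall x, (pi x != 0)%R -> x \is a GRing.unit &
      #|m| = #|[set x | pi x == 0%R]| ].
Proof.
have [pi [pi_surj m_pi]] := residue_map residue; exists pi; split=> //.
  by move=> x; rewrite -m_pi; apply: local_unit.
by apply: eq_card => x; rewrite inE m_pi.
Qed.

Lemma local_least_cover :
    least_cover (unit_powers F k) gF -> is_girth (@G F k) g ->
  let gR := local_waring k #|m| gF g in
  least_cover (nonzero_powers R k) gR /\
  (1 < k \/ #|m| = 1 -> least_cover (unit_powers R k) gR).
Proof.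
move=> wF gF_g /=; have [pi [pi_surj pi_unit ->]] := local_residue_map.
rewrite /local_waring; set M := [set x | _].
have M0 : (0 \in M)%R by rewrite inE rmorph0.
have cardM1 : (#|M| == 1) = (M == [set 0%R]).
  apply/cards1P/eqP => [[x defM]|->]; last by exists 0%R.
  by move: M0; rewrite defM inE => /eqP->.
have [/eqP/[dup] M1 /eqP|M1] /= := boolP (#|M| == 1).
  rewrite cardM1 orbT => /eqP defM.
  by have [] := least_cover_lift_inj pi_surj pi_unit k_n0 defM wF.
rewrite orbF; have [k1|k_n1] := eqVneq k 1.
  split; last by case=> [|/eqP]; [rewrite k1 | rewrite (negPf M1)].
  have -> : gF = 1; last by rewrite k1; apply: least_cover1.
  apply: least_cover_inj wF _; rewrite k1 unit_powers_field.
  exact: least_cover1.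
have k_gt1 : 1 < k.
  by rewrite ltn_neqAle eq_sym k_n1 lt0n; apply: contraNneq k_n0 => ->.
rewrite cardM1 in M1.
by have [] := least_cover_lift pi_surj pi_unit k_n0 k_gt1 M1 wF gF_g.
Qed.

Lemma G_undirectedN1 : G_undirected R k -> (-1 \in unit_powers F k)%R.
Proof.
have [pi [pi_surj pi_unit _]] := local_residue_map.
rewrite -(rmorph1 pi) -rmorphN -(unit_powers_pi pi_surj pi_unit k_n0).
by move=> ->; apply: imset_f; rewrite -(expr1n R k) mem_unit_powers ?unitr1.
Qed.

End LocalRing.

Lemma G_undirected1 (R : finComUnitRingType) : G_undirected R 1.
Proof.
have clos (x : R) : x \in unit_powers R 1 -> (- x)%R \in unit_powers R 1.
  case/imsetP=> y; rewrite inE => uy ->; rewrite expr1 -[(- y)%R]expr1.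
  by rewrite mem_unit_powers ?unitrN.
apply/setP=> x; apply/idP/imsetP => [Ux|[y Uy ->]]; last exact: clos.
by exists (- x)%R; rewrite ?opprK ?clos.
Qed.

Theorem theorem4p3 (R : finComUnitRingType) (m : idealr R) (F : finFieldType)
  (p t k : nat)
  (R_local : local_ring m)
  (residue_field : ring_iso {ideal_quot m} F)
  (char_F : p \in [pchar F]%R)
  (card_F : #|F| = p ^ t)
  (k_coprime : coprime k p) :
  let q := #|F| in
  let k' := gcdn k q.-1 in
  dagger (q.-1 %/ k') p t ->
  exists gR gF girthF : nat,
  [/\ is_waring R k gR, is_waring F k gF & is_girth (@G F k) girthF] /\
  [/\ strongly_connected (@W R k),
      is_diameter (@W R k) gR &
      (1 < k \/ #|m| = 1 -> is_diameter (@G R k) gR)] /\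
  (G_undirected R k ->
    [/\ k' = 1 -> #|m| = 1 -> gR = 1,
        1 < k -> k' = 1 -> 2 <= #|m| -> gR = 2 &
        1 < k' -> gR = gF]) /\
  (~ G_undirected R k ->
    [/\ girthF <= gF \/ #|m| = 1 -> gR = gF &
        girthF > gF -> 2 <= #|m| -> gR = gF.+1]) /\
  (forall (R' : finComUnitRingType) (m' : idealr R'),
    local_ring m' -> ring_iso {ideal_quot m'} F ->
    [\/ #|m| = 1 <-> #|m'| = 1,
        k = 1,
        G_undirected R k /\ 1 < k' |
        ~ G_undirected R k /\ girthF <= gF] ->
    is_waring R' k gR).
Proof.
move=> q k' prim.
have k_n0 : (k%:R != 0 :> F)%R.
  rewrite -(dvdn_pcharf char_F) -prime_coprime ?(pcharf_prime char_F) //.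
  by rewrite coprime_sym.
have k_gt0 : 0 < k by rewrite lt0n; apply: contraNneq k_n0 => ->.
have [d covF] := unit_powers_cover k_gt0 char_F card_F prim.
have [gF wF] := least_cover_exists covF.
have [n _ SN1] := coversP _ _ covF (-1)%R.
have sum0 : (0 \in nsum (unit_powers F k) n.+1)%R.
  by rewrite -(subrr 1%R); apply: (@nsumD _ _ 1); rewrite ?nsum1 ?unit_powers1.
have [g girF] := girth_exists (ltn0Sn n) sum0.
have [wW wG] := local_least_cover R_local residue_field k_n0 wF girF.
have g_le2 := girth_le2 girF; have g_ge2 := girth_ge2 girF.
have g_leS := girth_leS wF girF; have gF1 := waring_field_eq1 k_gt0 wF.
have gF_gt0 := least_cover_gt0 wF.
have gF_gt1 : 1 < k' -> 1 < gF.
  by move=> k'1; rewrite ltn_neqAle eq_sym gF1 neq_ltn k'1 orbT gF_gt0.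
have und_g2 : G_undirected R k -> g = 2.
  move/(G_undirectedN1 R_local residue_field k_n0)/g_le2 => le_g2.
  by apply/eqP; rewrite eqn_leq le_g2.
have dir_n1 : ~ G_undirected R k -> (k == 1) = false.
  by case: eqP => // -> []; apply: G_undirected1.
exists (local_waring k #|m| gF g), gF, g; split.
  split; [exact/is_waringP | | by []].
  by apply/is_waringP; rewrite // -unit_powers_field.
split.
  split=> [||/wG]; last exact: least_cover_diameter.
    by case: wW => /covers_connected.
  exact: least_cover_diameter.
rewrite /local_waring; split; [|split].
- move=> und; rewrite (und_g2 und); split.
  + by move=> k'1 ->; rewrite orbT; apply/eqP; rewrite gF1 -/k' k'1.
  + move=> k1 k'1 m2; have -> : gF = 1 by apply/eqP; rewrite gF1 -/k' k'1.
    by rewrite !gtn_eqF.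
  + by move=> k'1; rewrite (maxn_idPl (gF_gt1 k'1)) if_same.
- move=> dir; rewrite dir_n1 //=; split=> [[le_g|->] //|lt_g m2].
    by rewrite (maxn_idPl le_g) if_same.
  rewrite gtn_eqF // (maxn_idPr (ltnW lt_g)); apply/eqP.
  by rewrite eqn_leq g_leS.
move=> R' m' R'_local residue' same; apply/is_waringP => //.
have [+ _] := local_least_cover R'_local residue' k_n0 wF girF.
rewrite /local_waring; case: same => [eq_m|->|[und k'1]|[dir le_g]] //.
- suff -> : (#|m'| == 1) = (#|m| == 1) by [].
  by apply/eqP/eqP => /eq_m.
- by rewrite (und_g2 und) (maxn_idPl (gF_gt1 k'1)) !if_same.
by rewrite (maxn_idPl le_g) !if_same.
Qed.
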